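(* Let $p \geq 0$ and let $G$ be a simple graph with at least one edge. Then for each $X \in \{\chi_f(G), \chi_q(G), \xi(G)\}$, $$\chi(G) \geq X \geq \xi_f(G) \geq 1 + \max\left\{ \frac{\mathcal{E}_p^+(G)}{\mathcal{E}_p^-(G)}, \frac{\mathcal{E}_p^-(G)}{\mathcal{E}_p^+(G)} \right\}^{\frac{1}{|p - 1|}}.$$
   Context: Graphs are simple (undirected, no loops or multiple edges). $A_G$ is the adjacency matrix of $G$, with eigenvalues $\lambda_1 \ge \cdots \ge \lambda_n$. For $p \ge 0$, the positive and negative $p$-energies are $\mathcal{E}_p^+(G) = \sum_{\lambda_i > 0} \lambda_i^p$ and $\mathcal{E}_p^-(G) = \sum_{\lambda_i<0} |\lambda_i|^p$ (sums over eigenvalues with multiplicity; in particular $\mathcal{E}_0^+ = n^+$ and $\mathcal{E}_0^- = n^-$ are the numbers of positive and negative eigenvalues). $\chi(G)$ is the chromatic number. Fractional chromatic number $\chi_f(G)$: the minimum of $\sum_{J} \sigma_J$ over all maps $\sigma$ from the set of independent sets of $G$ to $\mathbb{R}_{\ge 0}$ such that $\sum_{J \ni v} \sigma_J \ge 1$ for every vertex $v$. Quantum chromatic number $\chi_q(G)$: the smallest $r$ such that for some $d>0$ there are orthogonal projectors $P_{v,k} \in \mathbb{C}^{d\times d}$ ($v \in V$, $k \in [r]$) with $\sum_{k=1}^r P_{v,k} = I_d$ for all $v$ and $P_{v,k}P_{w,k} = O$ for all edges $vw$ and all $k$. Orthogonal rank $\xi(G)$: the smallest $d$ such that there are nonzero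 vectors $x_v \in \mathbb{C}^d$ with $x_v^* x_w = 0$ for every edge $vw$. A $d/r$-representation of $G$ is a family of rank-$r$ orthogonal projectors $P_v \in \mathbb{C}^{d\times d}$, $v \in V(G)$, with $P_vP_w = O$ for every edge $vw$; the projective rank is $\xi_f(G) = \inf\{d/r : G \text{ has a } d/r\text{-representation}\}$. *)

(* Defs.v *)
From HB Require Import structures.
From mathcomp Require Import all_boot all_order all_algebra.
From mathcomp Require Import complex.
From mathcomp Require Import all_classical all_reals all_analysis.

Set Implicit Arguments.
Unset Strict Implicit.
Unset Printing Implicit Defensive.

Import Order.TTheory GRing.Theory Num.Theory.
Local Open Scope ring_scope.
Local Open Scope classical_set_scope.
Local Open Scope complex_scope.
Local Open Scope sesquilinear_scope.

(* A simple graph on the vertex set 'I_n is a symmetric irreflexive relation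
   e : rel 'I_n (these properties are hypotheses of the theorem).
   Complex numbers are R[i] for R : realType. *)

Section GraphParameters.
Variables (R : realType) (n : nat) (e : rel 'I_n).

Definition adjmx : 'M[R[i]]_n := \matrix_(i, j) (e i j)%:R.

(* eigenvalues lambda_1, ..., lambda_n of A_G (with multiplicity): the
   diagonal of the library's spectral decomposition A = P^-1 diag(sp) P;
   they are real since A_G is real symmetric, so we take real parts. *)
Definition eigval (i : 'I_n) : R := complex.Re (spectral_diag adjmx 0 i).

Definition Epos (p : R) : R := \sum_(i | 0 < eigval i) (eigval i) `^ p.
Definition Eneg (p : R) : R := \sum_(i | eigval i < 0) (- eigval i) `^ p.

Definition proper_colouring (k : nat) (f : 'I_n -> 'I_k) : Prop :=
  forall u v, e u v -> f u != f v.
Definition chrom : R :=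
  inf [set x | exists k : nat, (exists f, @proper_colouring k f) /\ x = k%:R].

Definition indep (J : {set 'I_n}) : bool :=
  [forall u in J, forall v in J, ~~ e u v].
Definition frac_chrom : R :=
  inf [set x | exists sigma : {set 'I_n} -> R,
        (forall J, 0 <= sigma J) /\
        (forall v, 1 <= \sum_(J | indep J && (v \in J)) sigma J) /\
        x = \sum_(J | indep J) sigma J].

Definition orthoproj (d : nat) (P : 'M[R[i]]_d) : Prop :=
  P *m P = P /\ P ^t* = P.

Definition quantum_chrom : R :=
  inf [set x | exists (r d : nat) (P : 'I_n -> 'I_r -> 'M[R[i]]_d),
        (0 < d)%N /\
        (forall v k, orthoproj (P v k)) /\
        (forall v, \sum_(k < r) P v k = 1%:M) /\
        (forall v w k, e v w -> P v k *m P w k = 0) /\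
        x = r%:R].

Definition orth_rank : R :=
  inf [set x | exists (d : nat) (X : 'I_n -> 'cV[R[i]]_d),
        (forall v, X v != 0) /\
        (forall v w, e v w -> (X v) ^t* *m X w = 0) /\
        x = d%:R].

Definition dr_representation (d r : nat) (P : 'I_n -> 'M[R[i]]_d) : Prop :=
  (forall v, orthoproj (P v) /\ \rank (P v) = r) /\
  (forall v w, e v w -> P v *m P w = 0).
Definition proj_rank : R :=
  inf [set x | exists (d r : nat) (P : 'I_n -> 'M[R[i]]_d),
        (0 < r)%N /\ dr_representation r P /\ x = d%:R / r%:R].

End GraphParameters.

Arguments adjmx {R n} e.
Arguments eigval {R n} e i.
Arguments Epos {R n} e p.
Arguments Eneg {R n} e p.
Arguments chrom {R n} e.
Arguments frac_chrom {R n} e.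
Arguments quantum_chrom {R n} e.
Arguments orth_rank {R n} e.
Arguments proj_rank {R n} e.

(* Main.v *)
(* Let A = X - Y be the decomposition of the adjacency matrix into its positive
   and negative parts, with eigenvalues lam_i > 0 and -mu_j < 0. For a
   d/r-representation (P_v), the block diagonal projector P = diag(P_v)
   satisfies P (X (x) I) P = P (Y (x) I) P =: T. Let tau_l be an orthonormal
   eigenbasis of T, with eigenvalues t_l, and let w_li be the squared norm of
   the component of P tau_l along the i-th eigenspace of A (x) I. Then
     sum_i w_li <= 1,  sum_(i > 0) lam_i w_li = sum_(j < 0) mu_j w_lj = t_l,
     sum_l w_li = r,   sum_l lam_i w_li / t_l <= d,
   the last inequality being Bessel's. For each l, lam_i w_li / t_l and
   mu_j w_lj / t_l are probability weights such that
     t_l (E[1/lam] + E[1/mu]) <= 1,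
   so a pointwise tangent-line inequality between powers of lam and mu,
   averaged over both weights and summed over l, compares sum lam_i^p with
   (d/r - 1)^|p-1| sum mu_j^p. Replacing A by -A exchanges the two energies. *)
Require Import Defs.
From HB Require Import structures.
From mathcomp Require Import all_boot all_order all_algebra.
From mathcomp Require Import ring lra.
From mathcomp Require Import complex.
From mathcomp Require Import all_classical all_reals all_analysis.
Set Implicit Arguments.
Unset Strict Implicit.
Unset Printing Implicit Defensive.

Import Order.TTheory GRing.Theory Num.Theory.
Local Open Scope ring_scope.
Local Open Scope complex_scope.
Local Open Scope sesquilinear_scope.

(** * Averaging inequalities for two families of probability weights *)

(** Chebyshev's sum inequality by symmetrization: the double sum of [a i * a j] times the products
    in the monotonicity hypothesis is nonnegative, and since the weights sum to [1] it expands to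
    twice the difference of the two sides. *)
Lemma chebyshev_sum (R : realFieldType) (I : finType) (P : pred I) (a x f : I -> R) :
  (forall i, P i -> 0 <= a i) -> \sum_(i | P i) a i = 1 ->
  (forall i j, P i -> P j -> 0 <= (f i - f j) * ((x j)^-1 - (x i)^-1)) ->
  \sum_(i | P i) a i * (f i / x i) <=
  (\sum_(i | P i) a i * f i) * (\sum_(i | P i) a i / x i).
Proof.
move=> a0 a1 mon.
set S1 := \sum_(i | P i) a i * (f i / x i); set S2 := _ * _.
have e1 : \sum_(i | P i) \sum_(j | P j) a i * a j * (f i / x i) = S1.
  by apply: eq_bigr => i _; rewrite -mulr_suml -mulr_sumr a1 mulr1.
have e1' : \sum_(i | P i) \sum_(j | P j) a i * a j * (f j / x j) = S1.
  rewrite exchange_big -e1; apply: eq_bigr => i _; apply: eq_bigr => j _.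
  by rewrite (mulrC (a i)).
have e2 : \sum_(i | P i) \sum_(j | P j) a i * a j * (f i / x j) = S2.
  rewrite /S2 mulr_suml; apply: eq_bigr => i _; rewrite mulr_sumr.
  by apply: eq_bigr => j _; ring.
have e2' : \sum_(i | P i) \sum_(j | P j) a i * a j * (f j / x i) = S2.
  rewrite exchange_big -e2; apply: eq_bigr => i _; apply: eq_bigr => j _.
  by rewrite (mulrC (a i)).
have : 0 <= \sum_(i | P i) \sum_(j | P j)
    a i * a j * ((f i - f j) * ((x j)^-1 - (x i)^-1)).
  apply: sumr_ge0 => i Pi; apply: sumr_ge0 => j Pj.
  by rewrite mulr_ge0 ?mon// mulr_ge0// a0.
have -> : \sum_(i | P i) \sum_(j | P j)
    a i * a j * ((f i - f j) * ((x j)^-1 - (x i)^-1)) = S2 + S2 - S1 - S1.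
  rewrite -{1}e2 -e2' -{1}e1 -e1' -big_split -!sumrB.
  apply: eq_bigr => i _; rewrite -big_split -!sumrB.
  by apply: eq_bigr => j _; rewrite /=; ring.
by lra.
Qed.

(** Averaging the pointwise inequality over the product weights [a i * b j] leaves a mixed term in
    the mean [Y] of [1 / y]. The budget [t * (X + Y) <= 1] trades [Y] for [X], and Chebyshev's
    inequality then replaces [F * X] by [G]. *)
Lemma two_sided_mean_ineq (R : realFieldType) (I : finType) (P Q : pred I)
    (a b x y f h : I -> R) (A B c t : R) :
  0 <= A -> 0 < t ->
  (forall i, P i -> 0 <= a i) -> \sum_(i | P i) a i = 1 ->
  (forall i, Q i -> 0 <= b i) -> \sum_(i | Q i) b i = 1 ->
  (forall i, P i -> 0 <= f i) ->
  t * (\sum_(i | P i) a i / x i + \sum_(j | Q j) b j / y j) <= 1 ->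
  (forall i j, P i -> P j -> 0 <= (f i - f j) * ((x j)^-1 - (x i)^-1)) ->
  (forall i j, P i -> Q j ->
     0 <= A * (f i / y j) + (A + B) * (f i / x i) + c * h j) ->
  0 <= A * (\sum_(i | P i) a i * f i)
     + t * (B * (\sum_(i | P i) a i * (f i / x i)) + c * \sum_(j | Q j) b j * h j).
Proof.
move=> A0 t0 a0 a1 b0 b1 f0 tle mon pt.
have := chebyshev_sum a0 a1 mon.
set F := \sum_(i | P i) a i * f i in tle *.
set G := \sum_(i | P i) a i * (f i / x i).
set H := \sum_(j | Q j) b j * h j.
set X := \sum_(i | P i) a i / x i in tle *.
set Y := \sum_(j | Q j) b j / y j in tle * => GFX.
have F0 : 0 <= F by apply: sumr_ge0 => i Pi; rewrite mulr_ge0 ?a0 ?f0.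
have : 0 <= \sum_(i | P i) \sum_(j | Q j)
    a i * b j * (A * (f i / y j) + (A + B) * (f i / x i) + c * h j).
  apply: sumr_ge0 => i Pi; apply: sumr_ge0 => j Qj.
  by rewrite mulr_ge0 ?pt// mulr_ge0 ?a0 ?b0.
have -> : \sum_(i | P i) \sum_(j | Q j)
    a i * b j * (A * (f i / y j) + (A + B) * (f i / x i) + c * h j)
    = A * (F * Y) + (A + B) * G + c * H.
  have -> : A * (F * Y) = \sum_(i | P i) \sum_(j | Q j) a i * b j * (A * (f i / y j)).
    rewrite mulr_suml mulr_sumr; apply: eq_bigr => i _.
    by rewrite !mulr_sumr; apply: eq_bigr => j _; ring.
  have -> : (A + B) * G = \sum_(i | P i) \sum_(j | Q j) a i * b j * ((A + B) * (f i / x i)).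
    rewrite mulr_sumr; apply: eq_bigr => i _.
    by rewrite -mulr_suml -mulr_sumr b1; ring.
  have -> : c * H = \sum_(i | P i) \sum_(j | Q j) a i * b j * (c * h j).
    rewrite exchange_big mulr_sumr; apply: eq_bigr => j _.
    by rewrite /= -mulr_suml -mulr_suml a1; ring.
  rewrite -!big_split; apply: eq_bigr => i _; rewrite -!big_split.
  by apply: eq_bigr => j _; rewrite /=; ring.
move=> pos.
(* The claim is exactly the sum of [h1], [h2] and [h3]: the terms in [F * X], [F * Y] and [A * G]
   cancel. *)
have h1 : 0 <= t * (A * (F * Y) + (A + B) * G + c * H) by rewrite mulr_ge0 // ltW.
have h2 : 0 <= t * (A * (F * X - G)).
  by rewrite mulr_ge0 ?(ltW t0)// mulr_ge0// subr_ge0.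
have h3 : 0 <= (A * F) * (1 - t * (X + Y)) by rewrite mulr_ge0 ?mulr_ge0// subr_ge0.
by nra.
Qed.

Lemma weighted_energy_ineq (R : realFieldType) (I L : finType) (lam : I -> R)
    (w : L -> I -> R) (f : R -> R) (A B c d r : R) :
  let t l := \sum_(i | 0 < lam i) lam i * w l i in
  0 <= A ->
  (forall l i, 0 <= w l i) ->
  (forall l, \sum_i w l i <= 1) ->
  (forall l, \sum_i lam i * w l i = 0) ->
  (forall i, \sum_l w l i = r) ->
  (forall i, 0 < lam i -> \sum_l lam i * w l i / t l <= d) ->
  (forall x, 0 < x -> 0 <= f x) ->
  (forall x y, 0 < x -> x <= y -> f x <= f y) ->
  (forall x y, 0 < x -> 0 < y ->
     0 <= A * (f x / y) + (A + B) * (f x / x) + c * (f y / y)) ->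
  0 <= (A * d + B * r) * (\sum_(i | 0 < lam i) f (lam i))
     + c * r * (\sum_(i | lam i < 0) f (- lam i)).
Proof.
move=> t A0 w0 w1 wlam wr wd f0 fmon pt.
have tneg l : t l = \sum_(i | lam i < 0) - lam i * w l i.
  have := wlam l; rewrite (bigID (fun i => 0 < lam i)) /= -/(t l).
  rewrite [X in _ + X](bigID (fun i => lam i < 0)) /=.
  rewrite [X in _ + (_ + X)]big1 ?addr0; last first.
    move=> i /andP[h1 h2]; have -> : lam i = 0 by lra.
    by rewrite mul0r.
  move=> /eqP; rewrite addr_eq0 => /eqP ->; rewrite -sumrN.
  apply: eq_big => i; last by rewrite mulNr.
  by rewrite -leNgt le_eqVlt; case: (ltgtP (lam i)); rewrite ?orbT.
have row l : 0 <= A * (\sum_(i | 0 < lam i) f (lam i) * (lam i * w l i / t l))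
    + B * (\sum_(i | 0 < lam i) f (lam i) * w l i)
    + c * (\sum_(i | lam i < 0) f (- lam i) * w l i).
  have tge0 : 0 <= t l by apply: sumr_ge0 => i li; rewrite mulr_ge0 ?w0// ltW.
  (* If [t l = 0], no normalization to probability weights is possible, but then every weight at a
     nonzero [lam i] vanishes and the row is trivial. *)
  have [t0|tn0] := eqVneq (t l) 0.
    have wp i : 0 < lam i -> w l i = 0.
      move=> li; have /psumr_eq0P := t0; move=> /(_ _ _ li) /eqP.
      rewrite mulf_eq0 gt_eqF//= => E; apply/eqP/E.
      by move=> j lj; rewrite mulr_ge0 ?w0// ltW.
    have wn i : lam i < 0 -> w l i = 0.
      move=> li; have := t0; rewrite tneg => /psumr_eq0P.
      move=> /(_ _ _ li) /eqP; rewrite mulf_eq0 oppr_eq0 lt_eqF//= => E.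
      by apply/eqP/E => j lj; rewrite mulr_ge0 ?w0// oppr_ge0 ltW.
    rewrite !big1 ?mulr0 ?addr0// => i li; rewrite ?(wp i li) ?(wn i li);
      by rewrite ?mulr0 ?mul0r ?mulr0.
  have tp : 0 < t l by rewrite lt_neqAle eq_sym tn0.
  have := @two_sided_mean_ineq R I (fun i => 0 < lam i) (fun i => lam i < 0)
    (fun i => lam i * w l i / t l) (fun i => - lam i * w l i / t l)
    lam (fun i => - lam i) (fun i => f (lam i)) (fun i => f (- lam i) / - lam i)
    A B c (t l) A0 tp.
  have -> : \sum_(i | 0 < lam i) lam i * w l i / t l * f (lam i) =
     \sum_(i | 0 < lam i) f (lam i) * (lam i * w l i / t l).
    by apply: eq_bigr => i _; rewrite mulrC.
  have -> : \sum_(i | 0 < lam i) lam i * w l i / t l * (f (lam i) / lam i) =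
     (\sum_(i | 0 < lam i) f (lam i) * w l i) / t l.
    rewrite mulr_suml; apply: eq_bigr => i li.
    by field; rewrite tn0 gt_eqF.
  have -> : \sum_(i | lam i < 0) - lam i * w l i / t l * (f (- lam i) / - lam i) =
     (\sum_(i | lam i < 0) f (- lam i) * w l i) / t l.
    rewrite mulr_suml; apply: eq_bigr => i li.
    by field; rewrite tn0 ?oppr_eq0 lt_eqF.
  have -> : \sum_(i | 0 < lam i) lam i * w l i / t l / lam i =
     (\sum_(i | 0 < lam i) w l i) / t l.
    rewrite mulr_suml; apply: eq_bigr => i li.
    by field; rewrite tn0 gt_eqF.
  have -> : \sum_(i | lam i < 0) - lam i * w l i / t l / - lam i =
     (\sum_(i | lam i < 0) w l i) / t l.
    rewrite mulr_suml; apply: eq_bigr => i li.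
    by field; rewrite tn0 ?oppr_eq0 lt_eqF.
  move=> H; apply: le_trans (H _ _ _ _ _ _ _ _) _.
  - by move=> i li; rewrite divr_ge0// mulr_ge0 ?w0// ltW.
  - by rewrite -mulr_suml divff.
  - by move=> i li; rewrite divr_ge0// mulr_ge0 ?w0// oppr_ge0 ltW.
  - by rewrite -mulr_suml -tneg divff.
  - by move=> i; apply: f0.
  (* Multiplying by [t l] turns the two means of reciprocals into the total weight on the indices
     with [lam i] nonzero; the indices with [lam i = 0] only add to a sum bounded by [1]. *)
  - rewrite -mulrDl mulrC mulfVK//; apply: le_trans (w1 l).
    rewrite [X in _ <= X](bigID (fun i => 0 < lam i)) /= lerD2l.
    rewrite [X in _ <= X](bigID (fun i => lam i < 0)) /=.
    rewrite (eq_bigl (fun i => ~~ (0 < lam i) && (lam i < 0))).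
      by rewrite lerDl sumr_ge0.
    by move=> i /=; case: (ltgtP (lam i)).
  - move=> i j li lj; have [ij|ji] := leP (lam i) (lam j).
      by rewrite mulr_le0// subr_le0 ?fmon// lef_pV2.
    by rewrite mulr_ge0// subr_ge0 ?fmon ?lef_pV2// ltW.
  - by move=> i j li lj; apply: pt; rewrite ?oppr_gt0.
  rewrite le_eqVlt; apply/orP; left; apply/eqP.
  by field.
have : 0 <= \sum_l (A * (\sum_(i | 0 < lam i) f (lam i) * (lam i * w l i / t l))
    + B * (\sum_(i | 0 < lam i) f (lam i) * w l i)
    + c * (\sum_(i | lam i < 0) f (- lam i) * w l i)).
  by apply: sumr_ge0 => l _; exact: row.
rewrite !big_split /= -!mulr_sumr.
have -> : \sum_l \sum_(i | 0 < lam i) f (lam i) * w l i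
   = r * \sum_(i | 0 < lam i) f (lam i).
  rewrite exchange_big mulr_sumr; apply: eq_bigr => i _.
  by rewrite -mulr_sumr wr mulrC.
have -> : \sum_l \sum_(i | lam i < 0) f (- lam i) * w l i
   = r * \sum_(i | lam i < 0) f (- lam i).
  rewrite exchange_big mulr_sumr; apply: eq_bigr => i _.
  by rewrite -mulr_sumr wr mulrC.
have : \sum_l \sum_(i | 0 < lam i) f (lam i) * (lam i * w l i / t l)
   <= d * \sum_(i | 0 < lam i) f (lam i).
  rewrite exchange_big mulr_sumr; apply: ler_sum => i li /=.
  by rewrite -mulr_sumr mulrC ler_wpM2r ?f0 ?wd.
move=> /(ler_wpM2l A0) h1 h2.
by apply: le_trans h2 _; lra.
Qed.

(** * Tangent-line inequalities between powers *)

(** With [u = ln x - ln y - ln k], the expression is [x ^ (p-1)] times [(p-1) e^u - p + e^((1-p)u)].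
    Bounding both exponentials by [e^z >= 1 + z] makes all terms cancel; equality holds at
    [x = k y]. *)
Lemma powR_tangent_gt1 (R : realType) (p k x y : R) : 1 < p -> 0 < k -> 0 < x -> 0 < y ->
  0 <= (p - 1) / k * (x `^ p / y) - p * (x `^ p / x) + k `^ (p - 1) * (y `^ p / y).
Proof.
move=> p1 k0 x0 y0.
have pwE z q : 0 < z -> z `^ q = expR (q * ln z) by move=> z0; rewrite /powR gt_eqF.
rewrite !pwE//.
have lnE z : 0 < z -> expR (ln z) = z by move=> ?; rewrite lnK.
have -> : y^-1 = expR (- ln y) by rewrite expRN lnE.
have -> : x^-1 = expR (- ln x) by rewrite expRN lnE.
have -> : k^-1 = expR (- ln k) by rewrite expRN lnE.
set a := ln x; set b := ln y; set g := ln k.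
have h1 : 1 + (1 - p) * (a - b - g) <= expR ((1 - p) * (a - b - g)) by exact: expR_ge1Dx.
have h2 : 1 + (a - b - g) <= expR (a - b - g) by exact: expR_ge1Dx.
have -> : (p - 1) * expR (- g) * (expR (p * a) * expR (- b)) -
  p * (expR (p * a) * expR (- a)) + expR ((p - 1) * g) * (expR (p * b) * expR (- b))
  = expR ((p - 1) * a) * ((p - 1) * expR (a - b - g) - p + expR ((1 - p) * (a - b - g))).
  rewrite mulrDr mulrBr (mulrCA _ (p - 1)) -mulrA (mulrCA (expR (-g))) -!expRD.
  congr (_ + _); last by congr expR; ring.
  congr (_ - _); first by congr (_ * expR _); ring.
  by rewrite mulrC; congr (expR _ * _); ring.
rewrite mulr_ge0 ?expR_ge0//.
have h3 : (p - 1) * (1 + (a - b - g)) <= (p - 1) * expR (a - b - g) by rewrite ler_wpM2l//; lra.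
by lra.
Qed.

(** Same substitution: the expression is [y ^ (p-1)] times [(1-p) e^(pu) + p e^((p-1)u) - 1], and
    the two tangent lines at [u = 0] average to [1]. *)
Lemma powR_tangent_lt1 (R : realType) (p k x y : R) : 0 <= p -> p < 1 -> 0 < k -> 0 < x -> 0 < y ->
  0 <= (1 - p) * k `^ (- p) * (x `^ p / y) + p * k `^ (1 - p) * (x `^ p / x) - y `^ p / y.
Proof.
move=> p0 p1 k0 x0 y0.
have pwE z q : 0 < z -> z `^ q = expR (q * ln z) by move=> z0; rewrite /powR gt_eqF.
rewrite !pwE//.
have lnE z : 0 < z -> expR (ln z) = z by move=> ?; rewrite lnK.
have -> : y^-1 = expR (- ln y) by rewrite expRN lnE.
have -> : x^-1 = expR (- ln x) by rewrite expRN lnE.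
set a := ln x; set b := ln y; set g := ln k.
have h1 : 1 + (p - 1) * (a - b - g) <= expR ((p - 1) * (a - b - g)) by exact: expR_ge1Dx.
have h2 : 1 + p * (a - b - g) <= expR (p * (a - b - g)) by exact: expR_ge1Dx.
have -> : (1 - p) * expR (- p * g) * (expR (p * a) * expR (- b)) +
  p * expR ((1 - p) * g) * (expR (p * a) * expR (- a)) - expR (p * b) * expR (- b)
  = expR ((p - 1) * b) * ((1 - p) * expR (p * (a - b - g)) + p * expR ((p - 1) * (a - b - g)) - 1).
  rewrite mulrBr mulr1 mulrDr (mulrCA _ (1 - p)) (mulrCA _ p) -!mulrA -!expRD.
  by congr (_ * _ + _ * _ - _); congr expR; ring.
rewrite mulr_ge0 ?expR_ge0//.
have h3 : (1 - p) * (1 + p * (a - b - g)) <= (1 - p) * expR (p * (a - b - g)).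
  by rewrite ler_wpM2l//; lra.
have h4 : p * (1 + (p - 1) * (a - b - g)) <= p * expR ((p - 1) * (a - b - g)).
  by rewrite ler_wpM2l//; lra.
by lra.
Qed.

(** * Gram matrices, projectors and Bessel's inequality *)

Lemma adjmxM (C : numClosedFieldType) m n p (A : 'M[C]_(m, n)) (B : 'M[C]_(n, p)) :
  (A *m B)^t* = B^t* *m A^t*.
Proof. by rewrite trmx_mul map_mxM. Qed.

Lemma mulmx_adj_diag (C : numClosedFieldType) m n (A : 'M[C]_(m, n)) i :
  (A *m A^t*) i i = \sum_j `|A i j| ^+ 2.
Proof. by rewrite mxE; apply: eq_bigr => j _; rewrite !mxE normCK. Qed.

Lemma mulmx_adj_diag_ge (C : numClosedFieldType) n (A : 'M[C]_n) i :
  `|A i i| ^+ 2 <= (A *m A^t*) i i.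
Proof.
rewrite mulmx_adj_diag (bigD1 i)//= lerDl.
by apply: sumr_ge0 => j _; rewrite exprn_ge0.
Qed.

(** Row [i] of an orthogonal projector has squared norm [Q i i], so this entry dominates its own
    square. *)
Lemma diag_le1_proj (C : numClosedFieldType) n (Q : 'M[C]_n) i :
  Q *m Q = Q -> Q^t* = Q -> Q i i <= 1.
Proof.
move=> QQ Qa; have := mulmx_adj_diag_ge Q i; rewrite Qa QQ => h.
have q0 : 0 <= Q i i by apply: le_trans h; rewrite exprn_ge0.
move: h; rewrite ger0_norm// => h.
have [->|qn0] := eqVneq (Q i i) 0; first exact: ler01.
have qp : 0 < Q i i by rewrite lt_neqAle eq_sym qn0.
by rewrite -(ler_pM2l qp) mulr1 -expr2.
Qed.

(* Generalized Bessel inequality: the hypothesis says that the rows of [M i]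
   scaled by [sqrt (lam i)] form a matrix with orthogonal columns, of squared
   norms [t l]. *)
Lemma bessel_weights (C : numClosedFieldType) (n d N : nat) (lam : 'I_n -> C)
    (M : 'I_n -> 'M[C]_(d, N)) (t : 'rV[C]_N) (i : 'I_n) (S : pred 'I_n) :
  (forall i, S i -> 0 < lam i) ->
  \sum_(i | S i) lam i *: ((M i)^t* *m M i) = diag_mx t ->
  S i ->
  \sum_l lam i * ((M i)^t* *m M i) l l / t 0 l <= d%:R.
Proof.
move=> lam0 orth Si.
(* As [0^-1 = 0], [E] is the pseudo-inverse of [diag_mx t], even where some [t 0 l] vanish. *)
pose E : 'M[C]_N := diag_mx (map_mx GRing.inv t).
have t0 l : 0 <= t 0 l.
  have -> : t 0 l = diag_mx t l l by rewrite mxE eqxx mulr1n.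
  rewrite -orth summxE; apply: sumr_ge0 => j Sj; rewrite mxE mulr_ge0 ?(ltW (lam0 _ Sj))//.
  by rewrite -{2}(trmxCK (M j)) mulmx_adj_diag sumr_ge0// => k _; rewrite exprn_ge0.
have Ea : E^t* = E.
  rewrite tr_diag_mx map_diag_mx; congr diag_mx; apply/rowP => l; rewrite !mxE.
    by rewrite /= geC0_conj// invr_ge0.
have EDE : E *m diag_mx t *m E = E.
  rewrite !mulmx_diag; congr diag_mx; apply/rowP => l; rewrite !mxE.
  have [->|tn0] := eqVneq (t 0 l) 0; first by rewrite invr0 mulr0.
  by rewrite mulVf ?mul1r.
(* Let [G] stack the matrices [sqrt (lam j) M j]. Then [G E G^*] is an orthogonal projector whose
   blocks in block row [i] are [sqrt (lam i * lam j) Z j]; the diagonal entries of its block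
   [lam i * Z i] are thus at most [1], and the trace of this block is the sum to be bounded. *)
pose Z j := M i *m E *m (M j)^t*.
have ZE : \sum_(j | S j) lam j *: (Z j *m (Z j)^t*) = Z i.
  rewrite /Z -{3}EDE -orth.
  rewrite mulmx_sumr mulmx_suml mulmx_sumr mulmx_suml; apply: eq_bigr => j _.
  by rewrite !adjmxM trmxCK Ea -!(scalemxAl, scalemxAr) !mulmxA.
have sE a (X : 'M[C]_d) c : (a *: X) c c = a * X c c by rewrite mxE.
have Zc c : lam i * Z i c c <= 1.
  have h : lam i * `|Z i c c| ^+ 2 <= Z i c c.
    rewrite -{2}ZE summxE (bigD1 i)//= -[X in X <= _]addr0 lerD//.
      rewrite sE; apply: ler_wpM2l; [exact: ltW (lam0 _ Si) | exact: mulmx_adj_diag_ge].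
    apply: sumr_ge0 => j /andP[Sj _]; rewrite sE mulr_ge0 ?(ltW (lam0 _ Sj))//.
    by rewrite mulmx_adj_diag sumr_ge0// => k _; rewrite exprn_ge0.
  have z0 : 0 <= Z i c c.
    by apply: le_trans h; rewrite mulr_ge0 ?exprn_ge0// ltW// lam0.
  have [->|zn0] := eqVneq (Z i c c) 0; first by rewrite mulr0 ler01.
  have zp : 0 < Z i c c by rewrite lt_neqAle eq_sym zn0.
  by rewrite -(ler_pM2r zp) mul1r -mulrA -expr2; move: h; rewrite ger0_norm.
have -> : \sum_l lam i * ((M i)^t* *m M i) l l / t 0 l = \sum_c lam i * Z i c c.
  rewrite -mulr_sumr -/(mxtrace _) /Z mxtrace_mulC mulmxA /mxtrace mulr_sumr.
  apply: eq_bigr => l _; rewrite -mulrA; congr (_ * _).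
  by rewrite mul_mx_diag !mxE.
apply: le_trans (ler_sum _ (fun c _ => Zc c)) _.
by rewrite sumr_const card_ord.
Qed.

Lemma gram_hermitian (C : numClosedFieldType) m n (X : 'M[C]_(m, n)) :
  (X^t* *m X)^t* = X^t* *m X.
Proof. by rewrite adjmxM trmxCK. Qed.

Lemma gram_diag_ge0 (C : numClosedFieldType) m n (X : 'M[C]_(m, n)) l :
  0 <= (X^t* *m X) l l.
Proof.
rewrite -{2}(trmxCK X) mulmx_adj_diag; apply: sumr_ge0 => j _.
by rewrite exprn_ge0.
Qed.

(** * From matrix families to the weighted inequality *)

(** The weights are the diagonal entries of the Gram matrices. Their row sums are diagonal entries
    of the projector [Q], their column sums are traces, and the bound [d] is Bessel's inequality. *)
Lemma diagonalized_energy_ineq (R : realType) (n d r N : nat) (lam : 'I_n -> R)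
    (M : 'I_n -> 'M[R[i]]_(d, N)) (t : 'rV[R[i]]_N) (f : R -> R) (A B c : R) :
  let Q := \sum_i (M i)^t* *m M i in
  \sum_i (lam i)%:C *: ((M i)^t* *m M i) = 0 ->
  \sum_(i | 0 < lam i) (lam i)%:C *: ((M i)^t* *m M i) = diag_mx t ->
  Q *m Q = Q ->
  (forall i, \tr (M i *m (M i)^t*) = r%:R) ->
  0 <= A ->
  (forall x, 0 < x -> 0 <= f x) ->
  (forall x y, 0 < x -> x <= y -> f x <= f y) ->
  (forall x y, 0 < x -> 0 < y ->
     0 <= A * (f x / y) + (A + B) * (f x / x) + c * (f y / y)) ->
  0 <= (A * d%:R + B * r%:R) * (\sum_(i | 0 < lam i) f (lam i))
     + c * r%:R * (\sum_(i | lam i < 0) f (- lam i)).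
Proof.
move=> Q bal diag QQ tr A0 f0 fmon pt.
pose w l i := complex.Re (((M i)^t* *m M i) l l).
have wE l i : (w l i)%:C = ((M i)^t* *m M i) l l.
  by rewrite RRe_real// ger0_real// gram_diag_ge0.
have sE a (X : 'M[R[i]]_N) l m : (a *: X) l m = a * X l m by rewrite mxE.
have tE l : (\sum_(i | 0 < lam i) lam i * w l i)%:C = t 0 l.
  rewrite rmorph_sum /=.
  have -> : t 0 l = diag_mx t l l by rewrite mxE eqxx mulr1n.
  by rewrite -diag summxE; apply: eq_bigr => i _; rewrite rmorphM /= wE sE.
apply: (@weighted_energy_ineq R _ _ lam w f A B c) => //.
- by move=> l i; rewrite -ler0c wE gram_diag_ge0.
- move=> l; rewrite -lecR rmorph_sum /=.
  rewrite (eq_bigr (fun i => ((M i)^t* *m M i) l l)) => [|i _]; last exact: wE.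
  rewrite -summxE; apply: diag_le1_proj => //.
  rewrite /Q raddf_sum /= map_mx_sum; apply: eq_bigr => i _.
  exact: gram_hermitian.
- move=> l; apply/complexI; rewrite rmorph_sum /=.
  rewrite (eq_bigr (fun i => ((lam i)%:C *: ((M i)^t* *m M i)) l l)).
    by rewrite -summxE bal mxE.
  by move=> i _; rewrite rmorphM /= wE sE.
- move=> i; apply/complexI; rewrite rmorph_sum rmorph_nat -(tr i) mxtrace_mulC.
  by apply: eq_bigr => l _; exact: wE.
- move=> i li; rewrite -lecR rmorph_sum rmorph_nat /=.
  rewrite (eq_bigr (fun l => (lam i)%:C * ((M i)^t* *m M i) l l / t 0 l)).
    by apply: bessel_weights diag _ => // j; rewrite ltcR.
  by move=> l _; rewrite !rmorphM fmorphV /= wE tE.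
Qed.

(** [T] is Hermitian, so a unitary [V] diagonalizes it. Replacing each [M i] by [M i *m V^t*]
    conjugates all Gram matrices by [V] and keeps the balance, the idempotence and the traces. *)
Lemma energy_ineq (R : realType) (n d r N : nat) (lam : 'I_n -> R)
    (M : 'I_n -> 'M[R[i]]_(d, N)) (f : R -> R) (A B c : R) :
  let Q := \sum_i (M i)^t* *m M i in
  \sum_i (lam i)%:C *: ((M i)^t* *m M i) = 0 ->
  Q *m Q = Q ->
  (forall i, \tr (M i *m (M i)^t*) = r%:R) ->
  0 <= A ->
  (forall x, 0 < x -> 0 <= f x) ->
  (forall x y, 0 < x -> x <= y -> f x <= f y) ->
  (forall x y, 0 < x -> 0 < y ->
     0 <= A * (f x / y) + (A + B) * (f x / x) + c * (f y / y)) ->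
  0 <= (A * d%:R + B * r%:R) * (\sum_(i | 0 < lam i) f (lam i))
     + c * r%:R * (\sum_(i | lam i < 0) f (- lam i)).
Proof.
move=> Q bal QQ tr.
pose T := \sum_(i | 0 < lam i) (lam i)%:C *: ((M i)^t* *m M i).
have Ta : T^t* = T.
  rewrite /T raddf_sum /= map_mx_sum; apply: eq_bigr => i _.
  rewrite linearZ /= map_mxZ gram_hermitian; congr (_ *: _).
  exact: conjc_real.
have /orthomx_spectralP TE : T \is normalmx.
  by apply/normalmxP; rewrite Ta.
have := spectral_unitarymx T.
move: (spectralmx T) (spectral_diag T) TE => V D TE Vu.
have VV : V *m V^t* = 1%:M by exact/unitarymxP.
have VV' : V^t* *m V = 1%:M by exact: mulmx1C.
rewrite (invmx_unitary Vu) in TE.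
have gram i : (M i *m V^t*)^t* *m (M i *m V^t*) = V *m ((M i)^t* *m M i) *m V^t*.
  by rewrite adjmxM trmxCK !mulmxA.
have sums (P : pred 'I_n) (g : 'I_n -> R[i]) :
    \sum_(i | P i) g i *: ((M i *m V^t*)^t* *m (M i *m V^t*))
    = V *m (\sum_(i | P i) g i *: ((M i)^t* *m M i)) *m V^t*.
  rewrite mulmx_sumr mulmx_suml; apply: eq_bigr => i _.
  by rewrite gram -scalemxAr -scalemxAl.
have QE : \sum_i (M i *m V^t*)^t* *m (M i *m V^t*) = V *m Q *m V^t*.
  by rewrite mulmx_sumr mulmx_suml; apply: eq_bigr => i _; rewrite gram.
apply: (@diagonalized_energy_ineq R n d r N lam (fun i => M i *m V^t*) D).
- by rewrite sums bal mulmx0 mul0mx.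
- by rewrite sums -/T TE !mulmxA VV mul1mx -mulmxA VV mulmx1.
- rewrite QE !mulmxA; rewrite -(mulmxA (V *m Q)) VV' mulmx1.
  by rewrite -(mulmxA V) QQ.
- by move=> i; rewrite -(tr i) adjmxM trmxCK mulmxA -(mulmxA (M i)) VV' mulmx1.
Qed.

(** In a full-rank factorization [P = X Y], idempotence forces [Y X] to be the identity of size
    [\rank P], and [X Y] and [Y X] have the same trace. *)
Lemma mxtrace_idempotent (F : fieldType) n (P : 'M[F]_n) :
  P *m P = P -> \tr P = (\rank P)%:R.
Proof.
have [B] := row_fullP (col_base_full P).
have [D] := row_freeP (row_base_free P).
move: (col_base P) (row_base P) (mulmx_base P) B D.
move: (\rank P) => k X Y <- B D YD BX XYXY.
have : B *m (X *m Y *m (X *m Y)) *m D = B *m (X *m Y) *m D by rewrite XYXY.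
rewrite -!mulmxA YD mulmx1 !mulmxA BX !mul1mx => YX.
by rewrite mxtrace_mulC YX mxtrace1.
Qed.

Lemma map_mxdiag (aT rT : nmodType) (f : {additive aT -> rT}) n (p : 'I_n -> nat)
    (B : forall i, 'M[aT]_(p i)) :
  map_mx f (\mxdiag_i B i) = \mxdiag_i map_mx f (B i).
Proof.
transitivity (\mxblock_(i, j)
    map_mx f (if i == j then conform_mx 0 (B i) else (0 : 'M[aT]_(p i, p j)))).
  by apply/matrixP => i j; rewrite !mxE.
apply: eq_mxblock => i j.
by case: eqP => [<-|_]; rewrite ?conform_mx_id ?map_mx0.
Qed.

Lemma mulmx_mxdiag (R : pzSemiRingType) n (p : 'I_n -> nat)
    (B D : forall i, 'M[R]_(p i)) :
  (\mxdiag_i B i) *m (\mxdiag_i D i) = \mxdiag_i (B i *m D i).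
Proof.
rewrite [X in _ *m X]/mxdiag mul_mxdiag_mxblock; apply/eq_mxblock => i j.
by case: eqP => [<-|_]; rewrite ?conform_mx_id ?mulmx0.
Qed.

(** * The matrix family attached to a d/r-representation *)

Section Representation.
Variables (R : realType) (n : nat) (e : rel 'I_n).
Hypotheses (e_sym : symmetric e).

Let A : 'M[R[i]]_n := adjmx e.
Local Notation lam := (@eigval R n e).
Let U := spectralmx A.

Lemma adjmx_hermsym : A \is hermsymmx.
Proof.
apply: realsym_hermsym.
  by apply/is_hermitianmxP; rewrite scale1r; apply/matrixP => i j; rewrite !mxE e_sym.
by apply/mxOverP => i j; rewrite mxE realn.
Qed.

Lemma eigvalE i : (eigval e i)%:C = spectral_diag A 0 i.
Proof.
apply: RRe_real.
by have /mxOverP := hermitian_spectral_diag_real adjmx_hermsym.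
Qed.

Lemma adjmx_spectral v w :
  A v w = \sum_i (eigval e i)%:C * ((U i v)^* * U i w).
Proof.
have /orthomx_spectralP AE := hermitian_normalmx adjmx_hermsym.
rewrite {1}AE (invmx_unitary (spectral_unitarymx _)) mxE; apply: eq_bigr => i _.
rewrite mul_mx_diag !mxE eigvalE -/U -/A.
by rewrite mulrAC mulrC.
Qed.

Variables (d r : nat) (P : 'I_n -> 'M[R[i]]_d).
Hypothesis P_rep : dr_representation e r P.

Let PP v : P v *m P v = P v. Proof. by case: P_rep => /(_ v) [[]]. Qed.
Let Pa v : (P v)^t* = P v. Proof. by case: P_rep => /(_ v) [[]]. Qed.

(** This is row [i] of [U], tensored with the identity, times [diag(P_v)]; its Gram matrix
    compresses the [i]-th eigenprojector of the adjacency matrix, tensored with the identity, by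
    [diag(P_v)]. *)
Let M i : 'M[R[i]]_(d, \sum_(v < n) d) := \mxrow_v (U i v *: P v).

Lemma rep_row_adj i : (M i)^t* = \mxcol_v ((U i v)^* *: P v).
Proof.
rewrite /M tr_mxrow; apply/matrixP => a b; rewrite !mxE /= rmorphM.
by congr (_ * _); rewrite -{2}Pa !mxE.
Qed.

Lemma rep_row_gram i :
  (M i)^t* *m M i = \mxblock_(v, w) (((U i v)^* * U i w) *: (P v *m P w)).
Proof.
rewrite rep_row_adj mul_mxcol_mxrow; apply: eq_mxblock => v w.
by rewrite -scalemxAl -scalemxAr scalerA.
Qed.

(** Block [(v, w)] of the sum is [A v w *: (P v *m P w)]: the scalar vanishes on non-edges and the
    product on edges. *)
Lemma rep_balance : \sum_i (eigval e i)%:C *: ((M i)^t* *m M i) = 0.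
Proof.
rewrite -[RHS](mxblock0 (p_ := fun=> d) (q_ := fun=> d)).
transitivity (\sum_i \mxblock_(v, w)
    (((eigval e i)%:C * ((U i v)^* * U i w)) *: (P v *m P w))).
  apply: eq_bigr => i _; rewrite rep_row_gram.
  by apply/matrixP => a b; rewrite !mxE mulrA.
rewrite -mxblock_sum; apply: eq_mxblock => v w.
rewrite -scaler_suml -adjmx_spectral mxE.
have [evw|_] := boolP (e v w); last by rewrite scale0r.
by case: P_rep => _ ->//; rewrite scaler0.
Qed.

(** The columns of [U] are orthonormal, so only the diagonal blocks survive. *)
Lemma rep_row_sum : \sum_i (M i)^t* *m M i = \mxdiag_v P v.
Proof.
rewrite (eq_bigr _ (fun i _ => rep_row_gram i)) -mxblock_sum.
apply: eq_mxblock => v w; rewrite -scaler_suml.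
have /matrixP/(_ v w) : U^t* *m U = 1%:M.
  by apply: mulmx1C; apply/unitarymxP/spectral_unitarymx.
rewrite !mxE => UU.
have -> : \sum_i (U i v)^* * U i w = (v == w)%:R.
  by rewrite -UU; apply: eq_bigr => i _; rewrite !mxE.
case: eqP => [<-|_]; last by rewrite scale0r.
by rewrite scale1r PP conform_mx_id.
Qed.

Lemma rep_row_trace i : \tr (M i *m (M i)^t*) = r%:R.
Proof.
rewrite rep_row_adj mul_mxrow_mxcol raddf_sum /=.
transitivity (\sum_v (U i v * (U i v)^*) * r%:R).
  apply: eq_bigr => v _; rewrite -scalemxAl -scalemxAr scalerA PP linearZ /=.
  rewrite mxtrace_idempotent//; congr (_ * _%:R).
  by case: P_rep => /(_ v) [].
rewrite -mulr_suml.
have /matrixP/(_ i i) : U *m U^t* = 1%:M.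
  by apply/unitarymxP/spectral_unitarymx.
rewrite !mxE eqxx => UU.
have -> : \sum_v U i v * (U i v)^* = 1.
  by rewrite -[RHS]/(true%:R) -UU; apply: eq_bigr => v _; rewrite !mxE.
by rewrite mul1r.
Qed.

Lemma rep_energy_ineq (f : R -> R) (a b c : R) :
  0 <= a ->
  (forall x, 0 < x -> 0 <= f x) ->
  (forall x y, 0 < x -> x <= y -> f x <= f y) ->
  (forall x y, 0 < x -> 0 < y ->
     0 <= a * (f x / y) + (a + b) * (f x / x) + c * (f y / y)) ->
  let Lp := \sum_(i | 0 < lam i) f (lam i) in
  let Ln := \sum_(i | lam i < 0) f (- lam i) in
  0 <= (a * d%:R + b * r%:R) * Lp + c * r%:R * Ln /\
  0 <= (a * d%:R + b * r%:R) * Ln + c * r%:R * Lp.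
Proof.
move=> a0 f0 fmon pt Lp Ln.
have QQ : (\sum_i (M i)^t* *m M i) *m (\sum_i (M i)^t* *m M i) =
    \sum_i (M i)^t* *m M i.
  rewrite rep_row_sum mulmx_mxdiag.
  by apply: eq_mxdiag => v; rewrite PP.
split; first exact: energy_ineq rep_balance QQ rep_row_trace a0 f0 fmon pt.
have : 0 <= (a * d%:R + b * r%:R) * (\sum_(i | 0 < - lam i) f (- lam i))
     + c * r%:R * (\sum_(i | - lam i < 0) f (- - lam i)).
  apply: (@energy_ineq R n d r _ (fun i => - lam i) M f a b c) => //.
    rewrite (eq_bigr (fun i => - ((lam i)%:C *: ((M i)^t* *m M i)))) => [|i _].
      by rewrite sumrN rep_balance oppr0.
    by rewrite rmorphN scaleNr.
  exact: rep_row_trace.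
rewrite (eq_bigl (fun i => lam i < 0)) => [|i]; last by rewrite oppr_gt0.
rewrite [X in _ + _ * X](eq_bigl (fun i => 0 < lam i)) => [|i]; last by rewrite oppr_lt0.
by under [X in _ + _ * X]eq_bigr do rewrite opprK.
Qed.

End Representation.

(** * Energy bounds for a single representation *)

(** The projectors at the ends of an edge have orthogonal ranges of dimension [r] in dimension [d].
    This makes [d / r - 1] positive, as the tangent inequalities require. *)
Lemma rep_ratio_ge2 (R : realType) (n : nat) (e : rel 'I_n) (d r : nat)
    (P : 'I_n -> 'M[R[i]]_d) u v :
  (0 < r)%N -> dr_representation e r P -> e u v -> 2 <= d%:R / r%:R :> R.
Proof.
move=> r0 [rk orth] euv; rewrite ler_pdivlMr ?ltr0n// -natrM ler_nat.
have := mulmx0_rank_max (orth _ _ euv).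
by rewrite (rk u).2 (rk v).2 addnn mul2n.
Qed.

Lemma rep_energy_ratio (R : realType) (n : nat) (e : rel 'I_n) (d r : nat)
    (P : 'I_n -> 'M[R[i]]_d) (p : R) u v :
  symmetric e -> e u v -> (0 < r)%N -> dr_representation e r P ->
  0 <= p -> p != 1 ->
  let k := d%:R / r%:R - 1 : R in
  Epos e p <= k `^ `|p - 1| * Eneg e p /\ Eneg e p <= k `^ `|p - 1| * Epos e p.
Proof.
move=> es euv r0 rep p0 p1 k.
have k1 : 1 <= k by have := rep_ratio_ge2 r0 rep euv; rewrite /k; lra.
have k0 : 0 < k by lra.
have rp : 0 < r%:R :> R by rewrite ltr0n.
have dE : d%:R = r%:R * (k + 1) :> R by rewrite /k subrK mulrC divfK ?gt_eqF.
have pw0 (x : R) : 0 < x -> 0 <= x `^ p by move=> _; exact: powR_ge0.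
have pwm (x y : R) : 0 < x -> x <= y -> x `^ p <= y `^ p.
  by move=> x0 xy; apply: ge0_ler_powR; rewrite ?nnegrE// ?(ltW x0)//; lra.
have [pgt1|ple1] := ltP 1 p.
  have pe : `|p - 1| = p - 1 by rewrite ger0_norm//; lra.
  (* These constants have [a + b = - p], as in the tangent inequality, and give
     [a * d + b * r = - r]. *)
  have := @rep_energy_ineq R n e es d r P rep (fun x => x `^ p)
    ((p - 1) / k) (- p - (p - 1) / k) (k `^ (p - 1)).
  have -> : (p - 1) / k * d%:R + (- p - (p - 1) / k) * r%:R = - r%:R :> R.
    by rewrite dE; field; rewrite gt_eqF.
  case=> //; first by rewrite divr_ge0//; lra.
    move=> x y x0 y0; rewrite addrCA subrr addr0 mulNr.
    exact: powR_tangent_gt1.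
  rewrite -/(Epos e p) -/(Eneg e p) pe => h1 h2.
  by split; rewrite -(ler_pM2l rp); lra.
have plt1 : p < 1 by lra.
have pe : `|p - 1| = 1 - p by rewrite ler0_norm; lra.
(* Here [a + b = p * k ^ (1 - p)], as in the tangent inequality, and
   [a * d + b * r = k ^ (1 - p) * r]. *)
have := @rep_energy_ineq R n e es d r P rep (fun x => x `^ p)
  ((1 - p) * k `^ (- p)) (p * k `^ (1 - p) - (1 - p) * k `^ (- p)) (-1).
have kE : k `^ (1 - p) = k * k `^ (- p).
  by rewrite -{2}(powRr1 (ltW k0)) -powRD// (lt0r_neq0 k0) implybT.
have -> : (1 - p) * k `^ (- p) * d%:R + (p * k `^ (1 - p) - (1 - p) * k `^ (- p)) * r%:R
    = k `^ (1 - p) * r%:R.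
  by rewrite dE kE; ring.
case=> //; first by rewrite mulr_ge0 ?powR_ge0//; lra.
  move=> x y x0 y0; rewrite addrCA subrr addr0 mulN1r.
  exact: powR_tangent_lt1.
rewrite -/(Epos e p) -/(Eneg e p) pe => h1 h2.
by split; rewrite -(ler_pM2l rp); lra.
Qed.

Lemma rep_lower_bound (R : realType) (n : nat) (e : rel 'I_n) (d r : nat)
    (P : 'I_n -> 'M[R[i]]_d) (p : R) u v :
  symmetric e -> e u v -> (0 < r)%N -> dr_representation e r P -> 0 <= p ->
  1 + (Num.max (Epos e p / Eneg e p) (Eneg e p / Epos e p))
        `^ (`|p - 1|^-1) <= d%:R / r%:R.
Proof.
move=> es euv r0 rep p0.
have ge2 := rep_ratio_ge2 r0 rep euv.
(* At [p = 1] the exponent is [0^-1 = 0], so the power is [1] and the claim is [2 <= d / r]. *)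
have [->|p1] := eqVneq p 1.
  by rewrite subrr normr0 invr0 powRr0.
have [h1 h2] := rep_energy_ratio es euv r0 rep p0 p1.
set k := d%:R / r%:R - 1 in h1 h2.
have k0 : 0 <= k by rewrite /k; lra.
have pp : 0 < `|p - 1| by rewrite normr_gt0 subr_eq0.
have Ep0 : 0 <= Epos e p by apply: sumr_ge0 => i _; exact: powR_ge0.
have En0 : 0 <= Eneg e p by apply: sumr_ge0 => i _; exact: powR_ge0.
(* A zero denominator makes the quotient [0], for which the bound is immediate. *)
have ratio (x y : R) : 0 <= y -> x <= k `^ `|p - 1| * y -> x / y <= k `^ `|p - 1|.
  rewrite le_eqVlt => /orP[/eqP<- _|y0]; first by rewrite invr0 mulr0 powR_ge0.
  by rewrite ler_pdivrMr.
rewrite -lerBrDl -/k.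
have -> : k = (k `^ `|p - 1|) `^ (`|p - 1|^-1).
  by rewrite -powRrM mulfV ?powRr1// gt_eqF.
apply: ge0_ler_powR; rewrite ?nnegrE ?powR_ge0 ?invr_ge0 ?normr_ge0//.
  by rewrite le_max divr_ge0.
by rewrite ge_max !ratio.
Qed.

(** * Comparison of the chromatic parameters *)

Section Hierarchy.
Variables (R : realType) (n : nat) (e : rel 'I_n).

Lemma frac_chrom_le (sigma : {set 'I_n} -> R) :
  (forall J, 0 <= sigma J) ->
  (forall v, 1 <= \sum_(J | indep e J && (v \in J)) sigma J) ->
  frac_chrom e <= \sum_(J | indep e J) sigma J.
Proof.
move=> s0 s1; apply: ge_inf; last by exists sigma.
by exists 0 => _ [s [? [_ ->]]]; exact: sumr_ge0.
Qed.

Lemma quantum_chrom_le (r d : nat) (P : 'I_n -> 'I_r -> 'M[R[i]]_d) :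
  (0 < d)%N -> (forall v k, orthoproj (P v k)) ->
  (forall v, \sum_(k < r) P v k = 1%:M) ->
  (forall v w k, e v w -> P v k *m P w k = 0) ->
  quantum_chrom e <= r%:R :> R.
Proof.
move=> d0 Po P1 Pe; apply: ge_inf; last by exists r, d, P.
by exists 0 => _ [? [? [? [_ [_ [_ [_ ->]]]]]]].
Qed.

Lemma orth_rank_le (d : nat) (X : 'I_n -> 'cV[R[i]]_d) :
  (forall v, X v != 0) -> (forall v w, e v w -> (X v)^t* *m X w = 0) ->
  orth_rank e <= d%:R :> R.
Proof.
move=> X0 Xe; apply: ge_inf; last by exists d, X.
by exists 0 => _ [? [? [_ [_ ->]]]].
Qed.

Lemma proj_rank_le (d r : nat) (P : 'I_n -> 'M[R[i]]_d) :
  (0 < r)%N -> dr_representation e r P -> proj_rank e <= d%:R / r%:R :> R.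
Proof.
move=> r0 rep; apply: ge_inf; last by exists d, r, P.
by exists 0 => _ [? [? [? [_ [_ ->]]]]]; rewrite divr_ge0.
Qed.

(** In characteristic zero the trace of a projector determines its rank, so the constructions below
    need only a trace computation. *)
Lemma dr_representation_trace (d r : nat) (P : 'I_n -> 'M[R[i]]_d) :
  (forall v, orthoproj (P v)) -> (forall v, \tr (P v) = r%:R) ->
  (forall v w, e v w -> P v *m P w = 0) ->
  dr_representation e r P.
Proof.
move=> Po Pt Pe; split=> // v; split=> //.
apply/eqP; rewrite -(eqr_nat (R[i])) -mxtrace_idempotent ?Pt//.
by have [] := Po v.
Qed.

Lemma colouring_fractional (k : nat) (f : 'I_n -> 'I_k) : proper_colouring e f ->
  exists sigma : {set 'I_n} -> R,
    (forall J, 0 <= sigma J) /\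
    (forall v, 1 <= \sum_(J | indep e J && (v \in J)) sigma J) /\
    k%:R = \sum_(J | indep e J) sigma J.
Proof.
move=> f_col; pose cl c := [set v | f v == c]%SET.
have cl_indep c : indep e (cl c).
  apply/forall_inP => u; rewrite inE => /eqP fu.
  apply/forall_inP => v; rewrite inE => /eqP fv.
  by apply/negP => /f_col; rewrite fu fv eqxx.
pose sigma J : R := \sum_(c < k) (J == cl c)%:R.
have sumE (S : pred {set 'I_n}) : \sum_(J | S J) sigma J = \sum_(c < k) (S (cl c))%:R.
  rewrite exchange_big; apply: eq_bigr => c _.
  have [Sc|Sc] := boolP (S (cl c)).
    by rewrite (bigD1 (cl c))//= eqxx big1 ?addr0// => J /andP[_ /negPf ->].
  by rewrite big1// => J; case: eqP => // ->; rewrite (negPf Sc).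
exists sigma; split; first by move=> J; exact: sumr_ge0.
split.
  move=> v; rewrite sumE (bigD1 (f v))//= cl_indep inE eqxx lerDl.
  exact: sumr_ge0.
rewrite sumE (eq_bigr (fun=> 1)) => [|c _]; last by rewrite cl_indep.
by rewrite sumr_const card_ord.
Qed.

Lemma colouring_quantum (k : nat) (f : 'I_n -> 'I_k) : proper_colouring e f ->
  exists P : 'I_n -> 'I_k -> 'M[R[i]]_1,
    (forall v c, orthoproj (P v c)) /\
    (forall v, \sum_(c < k) P v c = 1%:M) /\
    (forall v w c, e v w -> P v c *m P w c = 0).
Proof.
move=> f_col; exists (fun v c => (f v == c)%:R%:M); split.
  move=> v c; split.
    by rewrite -scalar_mxM -natrM mulnb andbb.
  by rewrite tr_scalar_mx map_scalar_mx rmorph_nat.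
split.
  move=> v; rewrite (bigD1 (f v))//= eqxx big1 ?addr0// => c.
  by rewrite eq_sym => /negPf ->; rewrite raddf0.
move=> v w c /f_col fvw; rewrite -scalar_mxM -natrM mulnb.
suff -> : (f v == c) && (f w == c) = false by rewrite raddf0.
by apply: contraNF fvw => /andP[/eqP -> /eqP ->].
Qed.

Lemma colouring_orth (k : nat) (f : 'I_n -> 'I_k) : proper_colouring e f ->
  exists X : 'I_n -> 'cV[R[i]]_k,
    (forall v, X v != 0) /\ (forall v w, e v w -> (X v)^t* *m X w = 0).
Proof.
move=> f_col; exists (fun v => delta_mx (f v) 0); split.
  move=> v; apply/eqP => /matrixP/(_ (f v) 0); rewrite !mxE !eqxx => /eqP.
  by rewrite oner_eq0.
move=> v w /f_col fvw; rewrite trmx_delta map_delta_mx mul_delta_mx_cond.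
by rewrite (negPf fvw).
Qed.

Hypothesis e_irr : irreflexive e.

(** Shows that the sets defining the parameters are nonempty, which bounding their infima from below
    requires. *)
Lemma id_colouring : proper_colouring e id.
Proof. by move=> u v; apply: contraTN => /eqP ->; rewrite e_irr. Qed.

Lemma le_chrom (x : R) :
  (forall k (f : 'I_n -> 'I_k), proper_colouring e f -> x <= k%:R) ->
  x <= chrom e.
Proof.
move=> H; apply: lb_le_inf.
  by exists n%:R; exists n; split=> //; exists id; exact: id_colouring.
by move=> _ [k [[f fc] ->]]; exact: H fc.
Qed.

(** Placing the [r] projectors of a vertex on a block diagonal gives a projector of size [r * d]
    whose trace is that of their sum, [d]. *)
Lemma proj_rank_le_quantum : proj_rank e <= quantum_chrom e :> R.
Proof.
apply: lb_le_inf.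
  have [P [? [? ?]]] := colouring_quantum id_colouring.
  by exists n%:R; exists n, 1%N, P.
move=> _ [r [d [P [d0 [Po [P1 [Pe ->]]]]]]].
have -> : r%:R = (\sum_(c < r) d)%:R / d%:R :> R.
  by rewrite sum_nat_const card_ord natrM mulfK// pnatr_eq0 -lt0n.
apply: (@proj_rank_le _ _ (fun v => \mxdiag_c P v c)) => //.
apply: dr_representation_trace.
- move=> v; split.
    rewrite mulmx_mxdiag; apply: eq_mxdiag => c; by case: (Po v c).
  rewrite tr_mxdiag map_mxdiag; apply: eq_mxdiag => c; by case: (Po v c).
- move=> v; rewrite mxtrace_mxdiag -[RHS](mxtrace1 (R[i]) d) -(P1 v).
  by rewrite raddf_sum.
- move=> v w evw; rewrite mulmx_mxdiag -[RHS]mxdiag0; apply: eq_mxdiag => c.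
  exact: Pe.
Qed.

(** The projectors onto the lines spanned by the vectors form a representation of rank [1]. *)
Lemma proj_rank_le_orth : proj_rank e <= orth_rank e :> R.
Proof.
apply: lb_le_inf.
  have [X [? ?]] := colouring_orth id_colouring.
  by exists n%:R; exists n, X.
move=> _ [d [X [X0 [Xe ->]]]].
pose s v := ((X v)^t* *m X v) 0 0.
have sE v : (X v)^t* *m X v = (s v)%:M by exact: mx11_scalar.
have s_ge0 v : 0 <= s v by exact: gram_diag_ge0.
have s0 v : s v != 0.
  apply: contra (X0 v) => /eqP; rewrite /s -{2}(trmxCK (X v)) mulmx_adj_diag.
  move=> /psumr_eq0P H; apply/eqP/colP => j; rewrite mxE.
  have /eqP : `|(X v)^t* 0 j| ^+ 2 = 0 by apply: H => // k _; rewrite exprn_ge0.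
  by rewrite expf_eq0 /= normr_eq0 !mxE conjC_eq0 => /eqP.
rewrite -[d%:R]divr1; apply: (@proj_rank_le _ 1 (fun v => (s v)^-1 *: (X v *m (X v)^t*))) => //.
apply: dr_representation_trace.
- move=> v; split.
    rewrite -scalemxAl -scalemxAr !mulmxA -(mulmxA (X v)) sE mul_mx_scalar.
    by rewrite -scalemxAl !scalerA -?mulrA mulVf ?mulr1.
  rewrite linearZ /= map_mxZ adjmxM trmxCK; congr (_ *: _).
  by rewrite /= geC0_conj// invr_ge0.
- by move=> v; rewrite linearZ /= mxtrace_mulC sE mxtrace_scalar mulVf.
- move=> v w evw; rewrite -scalemxAl -scalemxAr !mulmxA -(mulmxA (X v)) Xe//.
  by rewrite mulmx0 mul0mx !scaler0.
Qed.

(** Disjoint sets of coordinates give orthogonal coordinate projectors; each [S v] is first trimmed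
    to exactly [r] elements to fix the rank. *)
Lemma proj_rank_le_sets (D : finType) (r : nat) (S : 'I_n -> {set D}) :
  (0 < r)%N -> (forall v, (r <= #|S v|)%N) ->
  (forall v w, e v w -> [disjoint S v & S w]) ->
  proj_rank e <= #|D|%:R / r%:R :> R.
Proof.
move=> r0 rS dis.
have exT v : exists T : {set D}, #|T| = r /\ T \subset S v.
  have /card_geqP[s [us <- sS]] := rS v; exists [set x in s]%SET; split.
    by rewrite cardsE; exact/card_uniqP.
  by apply/fintype.subsetP => x; rewrite inE => /sS.
have [T TS] := choice exT.
pose P v : 'M[R[i]]_#|D| := diag_mx (\row_k (enum_val k \in T v)%:R).
apply: (@proj_rank_le _ _ P r0); apply: dr_representation_trace.
- move=> v; split.
    rewrite mulmx_diag; congr diag_mx; apply/rowP => k; rewrite !mxE.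
    by rewrite -natrM mulnb andbb.
  rewrite tr_diag_mx map_diag_mx; congr diag_mx; apply/rowP => k; rewrite !mxE.
  by rewrite rmorph_nat.
- move=> v; transitivity (#|T v|%:R : R[i]); last by rewrite (TS v).1.
  rewrite mxtrace_diag -[in RHS]sum1_card natr_sum [RHS]big_mkcond /=.
  rewrite [RHS](reindex (@enum_val D D)) /=; last exact/onW_bij/enum_val_bij.
  by apply: eq_big => // k _; rewrite mxE; case: ifP.
- move=> v w /dis dvw; rewrite mulmx_diag; apply/matrixP => i j; rewrite !mxE.
  rewrite -natrM mulnb; case: andP => [[iv iw]|_]; last by rewrite mul0rn.
  have /pred0P/(_ (enum_val i)) := dvw.
  by rewrite /= (fintype.subsetP (TS v).2 _ iv) (fintype.subsetP (TS w).2 _ iw).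
Qed.

(* The weights [sigma J] are rounded up to [m J / N]; the coordinates of the
   representation are [m J] copies of each independent set [J], and vertex [v]
   projects onto [N] of the coordinates whose set contains [v]. *)
Lemma proj_rank_le_frac : proj_rank e <= frac_chrom e :> R.
Proof.
apply: lb_le_inf.
  have [sigma [? [? ?]]] := colouring_fractional id_colouring.
  by exists n%:R; exists sigma.
move=> _ [sigma [s0 [s1 ->]]].
set s := \sum_(J | _) _.
pose K : R := #|{set 'I_n}|%:R.
(* Rounding adds at most [1] to each of at most [K] multiplicities, hence at most [K / N] to the
   ratio. *)
have bound (N : nat) : (0 < N)%N -> proj_rank e <= s + K / N%:R.
  move=> N0.
  have N0' : 0 < N%:R :> R by rewrite ltr0n.
  pose m (J : {set 'I_n}) := if indep e J then (Num.truncn (N%:R * sigma J)).+1 else 0%N.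
  have m_ge J : indep e J -> N%:R * sigma J <= (m J)%:R.
    by move=> Ji; rewrite /m Ji ltW// truncnS_gt.
  have m_le J : indep e J -> (m J)%:R <= N%:R * sigma J + 1.
    by move=> Ji; rewrite /m Ji -natr1 lerD2r truncn_le// mulr_ge0.
  pose D : finType := {J : {set 'I_n} & 'I_(m J)}.
  have card (S : pred {set 'I_n}) : #|[set x : D | S (tag x)]%SET| = (\sum_(J | S J) m J)%N.
    rewrite -sum1dep_card.
    have -> : (\sum_(J | S J) m J = \sum_(J | S J) \sum_(j < m J) 1)%N.
      by apply: eq_bigr => J _; rewrite sum1_card card_ord.
    rewrite (sig_big_dep S (fun J => xpredT : pred 'I_(m J)) (fun J _ => 1%N)) /=.
    by apply: eq_bigl => x; rewrite andbT.
  apply: le_trans (@proj_rank_le_sets D N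
    (fun v => [set x : D | (v \in tag x)])%SET N0 _ _) _.
  - move=> v; rewrite (card (fun J => v \in J)) -(ler_nat R) natr_sum.
    apply: le_trans (_ : \sum_(J | indep e J && (v \in J)) (m J)%:R <= _).
      apply: le_trans (_ : \sum_(J | indep e J && (v \in J)) N%:R * sigma J <= _).
        by rewrite -mulr_sumr ler_pMr.
      by apply: ler_sum => J /andP[Ji _]; exact: m_ge.
    rewrite [leRHS](bigID (indep e)) /= (eq_bigl _ _ (fun J => andbC _ _)).
    by rewrite lerDl sumr_ge0.
  - move=> v w evw; apply/pred0P => x /=; rewrite !inE; apply/negP => /andP[vx wx].
    case: x vx wx => J j /= vJ wJ.
    (* A copy of [J] exists only when [J] is independent, which is impossible if [J] contains both
       ends of an edge. *)
    have : (0 < m J)%N by exact: leq_ltn_trans (ltn_ord j).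
    rewrite /m.
    case: ifP => // /forall_inP/(_ _ vJ)/forall_inP/(_ _ wJ).
    by rewrite evw.
  rewrite ler_pdivrMr// mulrDl divfK ?gt_eqF//.
  rewrite -cardsT.
  have -> : [set: D] = [set x : D | xpredT (tag x)]%SET by apply/setP => x; rewrite !inE.
  rewrite (card xpredT) natr_sum (bigID (indep e)) /= [X in _ + X]big1 ?addr0; last first.
    by move=> J /negPf Ji; rewrite /m Ji.
  apply: le_trans (ler_sum _ m_le) _.
  rewrite big_split /= -mulr_sumr -/s mulrC lerD2l sumr_const ler_nat.
  exact: max_card.
apply/ler_addgt0Pr => eps eps0.
(* Chosen so that [K / N <= eps]. *)
pose N := (Num.truncn (K / eps)).+1.
apply: le_trans (bound N _) _ => //; rewrite lerD2l ler_pdivrMr ?ltr0n//.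
by rewrite mulrC -ler_pdivrMr// ltW// truncnS_gt.
Qed.

Lemma le_proj_rank (x : R) :
  (forall d r (P : 'I_n -> 'M[R[i]]_d),
     (0 < r)%N -> dr_representation e r P -> x <= d%:R / r%:R) ->
  x <= proj_rank e.
Proof.
move=> H; apply: lb_le_inf; last by move=> _ [d [r [P [r0 [rep ->]]]]]; exact: H rep.
(* The projectors onto the coordinate axes, one axis per vertex, show that some representation
   exists. *)
exists (n%:R / 1%:R); exists n, 1%N, (fun v => delta_mx v v); split=> //; split=> //.
apply: dr_representation_trace.
- by move=> v; split; rewrite ?mul_delta_mx// trmx_delta map_delta_mx.
- move=> v; rewrite /mxtrace (bigD1 v)//= mxE !eqxx big1 ?addr0// => w.
  by rewrite mxE => /negPf ->.
- by move=> v w /id_colouring vw; rewrite mul_delta_mx_cond (negPf vw).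
Qed.

End Hierarchy.

Theorem theorem1p8 (R : realType) (n : nat) (e : rel 'I_n) (p : R) :
  symmetric e -> irreflexive e -> (exists u v, e u v) -> 0 <= p ->
  forall X : R,
    X = frac_chrom e \/ X = quantum_chrom e \/ X = orth_rank e ->
    [/\ X <= chrom e,
        proj_rank e <= X &
        1 + (Num.max (Epos e p / Eneg e p) (Eneg e p / Epos e p))
              `^ (`|p - 1|^-1) <= proj_rank e].
Proof.
move=> es ei [u [v euv]] p0 X XE; split.
- apply: le_chrom => // k f fc; case: XE => [->|[->|->]].
  + by have [sigma [s0 [s1 ->]]] := @colouring_fractional R n e k f fc; exact: frac_chrom_le.
  + have [P [? [? ?]]] := @colouring_quantum R n e k f fc.
    exact: (@quantum_chrom_le R n e k 1 P).
  + by have [Y [? ?]] := @colouring_orth R n e k f fc; exact: (@orth_rank_le R n e k Y).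
- case: XE => [->|[->|->]].
  + exact: proj_rank_le_frac.
  + exact: proj_rank_le_quantum.
  + exact: proj_rank_le_orth.
- apply: le_proj_rank => // d r P r0 rep.
  exact: (rep_lower_bound es euv r0 rep p0).
Qed.
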